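(* Let $\Gamma$ be the generic symmetric $d\times d$ matrix with zero diagonal and off-diagonal entries the variables $\gamma_{ij}$ ($1\le i<j\le d$). Let $A,B,C\subset[d]$ be pairwise disjoint. Then the ideal of $\mathbb{C}[\gamma_{ij}\mid 1\le i<j\le d]$ generated by all $(\#C+2)\times(\#C+2)$ minors of $\operatorname{CM}(\Gamma_{A\cup C,\,B\cup C})$ is equal to $$\big\langle \det\operatorname{CM}(\Gamma_{A',B'})\ \big|\ A'\subset A\cup C,\ B'\subset B\cup C,\ \#A'=\#B'=\#C+1\big\rangle .$$ Consequently, for an undirected graph $G$ with vertex set $[d]$, the extremal conditional independence ideal of $G$ equals $$\operatorname{eCI}_G=\sum_{A\perp_e B\mid C}\big\langle \det\operatorname{CM}(\Gamma_{A',B'})\ \big|\ A'\subset A\cup C,\ B'\subset B\cup C,\ \#A'=\#B'=\#C+1\big\rangle .$$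
   Context: $[d]=\{1,\dots,d\}$. $\Gamma_{I,J}$ denotes the submatrix of $\Gamma$ with rows $I$ and columns $J$ and $$\operatorname{CM}(\Gamma_{I,J})=\begin{pmatrix}-\tfrac12\Gamma_{I,J}&\mathbf{1}\\ \mathbf{1}^\top&0\end{pmatrix}.$$ For a graph $G$ on vertex set $[d]$, sums indexed by $A\perp_e B\mid C$ range over all triples of pairwise disjoint subsets $A,B,C\subset[d]$ such that $C$ separates $A$ from $B$ in $G$ (every path from a vertex of $A$ to a vertex of $B$ meets $C$). The extremal conditional independence ideal of $G$ is by definition $$\operatorname{eCI}_G=\sum_{A\perp_e B\mid C}\big\langle (\#C+2)\times(\#C+2)\text{ minors of }\operatorname{CM}(\Gamma_{A\cup C,\,B\cup C})\big\rangle\subset\mathbb{C}[\gamma_{ij}\mid 1\le i<j\le d].$$ *)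

(* Defs.v *)
From HB Require Import structures.
From mathcomp Require Import all_boot all_order all_algebra.
From mathcomp Require Import classical_sets reals.
From mathcomp Require Import complex.
From mathcomp Require Import mpoly.

Set Implicit Arguments.
Unset Strict Implicit.
Unset Printing Implicit Defensive.

Import GRing.Theory Num.Theory.

Local Open Scope ring_scope.

(* Stated before classical_set_scope is opened, which rebinds [disjoint _ & _]. *)
Definition pairwise_disjoint (d : nat) (A B C : {set 'I_d}) : Prop :=
  [/\ [disjoint A & B], [disjoint A & C] & [disjoint B & C]].

Local Open Scope classical_set_scope.

Definition ideal_gen (R : comNzRingType) (S : set R) : set R :=
  [set p | exists (n : nat) (a s : 'I_n -> R),
     (forall i, S (s i)) /\ p = \sum_(i < n) a i * s i].

(* Sum of a family of ideals, indexed by the t with P t.  The t i need not be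
   distinct, which is harmless as each I t is closed under addition. *)
Definition ideal_sum (R : comNzRingType) (T : Type) (P : set T)
    (I : T -> set R) : set R :=
  [set p | exists (n : nat) (t : 'I_n -> T) (q : 'I_n -> R),
     (forall i, P (t i) /\ I (t i) (q i)) /\ p = \sum_(i < n) q i].

Definition is_minor (R : comNzRingType) (k m n : nat) (M : 'M[R]_(m, n))
    : set R :=
  [set p | exists (f : 'I_k -> 'I_m) (g : 'I_k -> 'I_n),
     [/\ {homo f : i j / (i < j)%N}, {homo g : i j / (i < j)%N}
       & p = \det (mxsub f g M)]].

Definition var_index (d : nat) := {ij : 'I_d * 'I_d | (ij.1 < ij.2)%N}.

(* mpoly variables are numbered by an ordinal; enum_rank numbers the pairs. *)
Notation gpoly K d := {mpoly K[#|{: var_index d}|]}.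

Definition gvar (K : fieldType) (d : nat) (ij : var_index d) : gpoly K d :=
  'X_(enum_rank ij).

Definition Gamma (K : fieldType) (d : nat) : 'M[gpoly K d]_d :=
  \matrix_(i, j)
    if insub (i, j) is Some ij then gvar K ij
    else if insub (j, i) is Some ji then gvar K ji
    else 0.

(* enum_val lists a subset of 'I_d in increasing order. *)
Definition Gamma_sub (K : fieldType) (d : nat) (I J : {set 'I_d})
    : 'M[gpoly K d]_(#|I|, #|J|) :=
  mxsub (@enum_val _ (mem I)) (@enum_val _ (mem J)) (Gamma K d).

Definition CM (K : fieldType) (v m n : nat) (M : 'M[{mpoly K[v]}]_(m, n))
    : 'M[{mpoly K[v]}]_(m + 1, n + 1) :=
  block_mx ((- 2%:R^-1)%:MP *: M) (const_mx 1) (const_mx 1) 0.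

Definition minor_ideal (K : fieldType) (d : nat) (A B C : {set 'I_d})
    : set (gpoly K d) :=
  ideal_gen (is_minor (#|C| + 2) (CM (Gamma_sub K (A :|: C) (B :|: C)))).

(* castmx makes the matrix visibly square, so that \det applies. *)
Definition det_ideal (K : fieldType) (d : nat) (A B C : {set 'I_d})
    : set (gpoly K d) :=
  ideal_gen [set p | exists (A' B' : {set 'I_d})
       (hA : #|A'| = (#|C| + 1)%N) (hB : #|B'| = (#|C| + 1)%N),
     [/\ A' \subset A :|: C, B' \subset B :|: C
       & p = \det (CM (castmx (hA, hB) (Gamma_sub K A' B')))]].

Arguments minor_ideal K {d} A B C.
Arguments det_ideal K {d} A B C.

Definition separates (d : nat) (e : rel 'I_d) (A B C : {set 'I_d}) : Prop :=
  forall (a : 'I_d) (p : seq 'I_d),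
    a \in A -> last a p \in B -> path e a p -> uniq (a :: p) ->
    exists2 c, c \in a :: p & c \in C.

Definition ci_triples (d : nat) (e : rel 'I_d)
    : set ({set 'I_d} * {set 'I_d} * {set 'I_d}) :=
  [set t | pairwise_disjoint t.1.1 t.1.2 t.2 /\ separates e t.1.1 t.1.2 t.2].

Definition eCI (K : fieldType) (d : nat) (e : rel 'I_d) : set (gpoly K d) :=
  ideal_sum (ci_triples e) (fun t => minor_ideal K t.1.1 t.1.2 t.2).

Arguments eCI K {d} e.

(* Main.v *)
Require Import Defs.
From HB Require Import structures.
From mathcomp Require Import all_boot all_order all_algebra.
From mathcomp Require Import boolp classical_sets reals.
From mathcomp Require Import complex.
From mathcomp Require Import mpoly.

(** Let [n = #|C| + 1]. A minor of size [n + 1] of the bordered matrix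
[CM (Gamma_sub (A :|: C) (B :|: C))] that uses both the border row and the
border column is the determinant of [CM (Gamma_sub A' B')], where [A'] and [B']
collect the other [n] rows and [n] columns; these are exactly the generators of
the second ideal ([subset_of_homo], [homo_of_subset], [mxsub_CM]). What has to
be shown is that the minors avoiding the border row or the border column bring
nothing new.

Take rows [f] and columns [g] with the border column [c] not among [g]. Adjoin
[c] as a last column and repeat below a row [f i0] whose entry in column [c] is
1. The resulting square matrix has two equal rows, so its determinant vanishes;
expanding it along the repeated row writes the minor on [f], [g] as a linear
combination of minors on the same rows [f] whose columns include [c]
([minor_border_col]). By transposition the same holds for rows. The unit entry
exists because a minor has at least two rows and two columns, so that some
row other than the border row, and some column other than the border column,
is present. Applying the column step and then the row step puts every minor in
the ideal of the minors using both borders ([minors_border]).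

This gives the equality of the two ideals ([minor_ideal_det_ideal]); the
statement for a graph follows by summing over its separation triples. *)

Set Implicit Arguments.
Unset Strict Implicit.
Unset Printing Implicit Defensive.

Import GRing.Theory.
Local Open Scope ring_scope.

(** * Closure properties of generated ideals *)

Section IdealGen.
Variables (R : comNzRingType) (S : set R).

Lemma ideal_gen_mem p : S p -> ideal_gen S p.
Proof.
move=> Sp; exists 1, (fun=> 1), (fun=> p); split=> //.
by rewrite big_ord1 mul1r.
Qed.

Lemma ideal_gen0 : ideal_gen S 0.
Proof.
exists 0, (fun=> 0), (fun=> 0); split; first by case.
by rewrite big_ord0.
Qed.

Lemma ideal_genD p q : ideal_gen S p -> ideal_gen S q -> ideal_gen S (p + q).
Proof.
move=> [m [a [s [Ss ->]]]] [n [b [t [St ->]]]].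
exists (m + n)%N.
exists (fun i => match split i with inl j => a j | inr j => b j end).
exists (fun i => match split i with inl j => s j | inr j => t j end).
split=> [i|]; first by case: (split i).
rewrite big_split_ord; congr (_ + _); apply: eq_bigr => i _.
  by rewrite (unsplitK (inl i)).
by rewrite (unsplitK (inr i)).
Qed.

Lemma ideal_genMl a p : ideal_gen S p -> ideal_gen S (a * p).
Proof.
move=> [m [b [s [Ss ->]]]]; exists m, (fun i => a * b i), s; split=> //.
by rewrite mulr_sumr; apply: eq_bigr => i _; rewrite mulrA.
Qed.

Lemma ideal_gen_sum n (a s : 'I_n -> R) :
  (forall i, ideal_gen S (s i)) -> ideal_gen S (\sum_i a i * s i).
Proof.
move=> Ss; elim/big_ind: _ => [||i _]; first exact: ideal_gen0.
  exact: ideal_genD.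
exact: ideal_genMl.
Qed.

End IdealGen.

Lemma ideal_gen_sub (R : comNzRingType) (S T : set R) :
  (forall p, S p -> ideal_gen T p) -> forall p, ideal_gen S p -> ideal_gen T p.
Proof. by move=> ST p [n [a [s [Ss ->]]]]; apply: ideal_gen_sum => i; apply: ST. Qed.

(** * Minors avoiding the border row or column *)

(** The new index goes last: since the border index is the largest one, a
strictly increasing family stays strictly increasing. *)
Definition ord_rcons (T : Type) k (g : 'I_k -> T) (c : T) (j : 'I_k.+1) : T :=
  if unlift ord_max j is Some j' then g j' else c.

Lemma ord_rcons_lift (T : Type) k (g : 'I_k -> T) c j :
  ord_rcons g c (lift ord_max j) = g j.
Proof. by rewrite /ord_rcons liftK. Qed.

Lemma ord_rcons_max (T : Type) k (g : 'I_k -> T) c :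
  ord_rcons g c ord_max = c.
Proof. by rewrite /ord_rcons unlift_none. Qed.

Lemma ord_rcons_homo k n (g : 'I_k -> 'I_n) (c : 'I_n) :
  {homo g : i j / (i < j)%N} -> (forall j, g j < c)%N ->
  {homo ord_rcons g c : i j / (i < j)%N}.
Proof.
move=> hg gc i j.
case: (unliftP ord_max j) => [j'|] ->; case: (unliftP ord_max i) => [i'|] ->.
- by rewrite !ord_rcons_lift !lift_max; apply: hg.
- by rewrite lift_max /= ltnNge ltnW.
- by rewrite ord_rcons_lift ord_rcons_max => _; apply: gc.
- by rewrite ltnn.
Qed.

Lemma lift_homo k (h : 'I_k.+1) : {homo lift h : i j / (i < j)%N}.
Proof.
move=> i j; rewrite /= /bump => ij.
case: (leqP h i) => hi; first by rewrite (leq_trans hi (ltnW ij)) ltnS.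
by rewrite add0n ltn_addl.
Qed.

(** The determinant on rows [f], [f i0] and columns [g], [c] vanishes, having a
repeated row. In its expansion along that row, the term of column [c] is the
minor on [f] and [g], and every other term is a multiple of a minor that omits
one column of [g] and keeps [c]. *)
Lemma minor_border_col (R : comNzRingType) (S : set R) k m n (M : 'M[R]_(m, n))
    (f : 'I_k -> 'I_m) (g : 'I_k -> 'I_n) (c : 'I_n) (i0 : 'I_k) :
  M (f i0) c = 1 ->
  (forall j, ideal_gen S
     (\det (mxsub f (ord_rcons g c \o lift (lift ord_max j)) M))) ->
  ideal_gen S (\det (mxsub f g M)).
Proof.
move=> Mc1 HS.
pose B := mxsub (ord_rcons f (f i0)) (ord_rcons g c) M.
have detB0 : \det B = 0.
  apply: (determinant_alternate (neq_lift ord_max i0)) => j.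
  by rewrite !mxE ord_rcons_max ord_rcons_lift.
have minorB h : row' ord_max (col' h B) = mxsub f (ord_rcons g c \o lift h) M.
  by apply/matrixP => i j; rewrite !mxE ord_rcons_lift.
move: detB0; rewrite (expand_det_row _ ord_max) big_ord_recr /=.
(* The corner cofactor carries the sign (-1)^(k + k) = 1. *)
rewrite /cofactor minorB -signr_odd oddD addbb mul1r.
rewrite mxE !ord_rcons_max Mc1 mul1r => /eqP; rewrite addrC addr_eq0 => /eqP detE.
have -> : mxsub f g M = mxsub f (ord_rcons g c \o lift ord_max) M.
  by apply/matrixP => i j; rewrite !mxE /= ord_rcons_lift.
rewrite detE -[X in ideal_gen S X]mulN1r; apply: ideal_genMl; apply: ideal_gen_sum => j.
rewrite minorB; apply: ideal_genMl.
suff -> : widen_ord (leqnSn k) j = lift ord_max j by apply: HS.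
by apply: val_inj; apply: esym (lift_max j).
Qed.

(** Column step: since [c] is the largest index, the minors produced by
[minor_border_col] again have increasing columns, so no reordering signs or
repeated columns arise. *)
Lemma minors_border_col (R : comNzRingType) (S : set R) k m n
    (M : 'M[R]_(m, n)) (c : 'I_n) (f : 'I_k -> 'I_m) (i0 : 'I_k) :
  (forall j : 'I_n, j <= c)%N -> M (f i0) c = 1 ->
  (forall g : 'I_k -> 'I_n, {homo g : i j / (i < j)%N} ->
     (exists j, g j = c) -> ideal_gen S (\det (mxsub f g M))) ->
  forall g : 'I_k -> 'I_n, {homo g : i j / (i < j)%N} ->
    ideal_gen S (\det (mxsub f g M)).
Proof.
move=> c_max Mc1 HS g hg.
have [[j gj]|gNc] := pselect (exists j, g j = c); first by apply: HS => //; exists j.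
apply: (minor_border_col Mc1) => j; apply: HS => [x y xy|] /=.
  apply: ord_rcons_homo => // [z|]; last exact: lift_homo.
  rewrite ltn_neqAle c_max andbT; apply/eqP => gz; apply: gNc.
  by exists z; apply: val_inj.
have [|x maxE _] := @unlift_some _ (lift ord_max j) ord_max.
  by rewrite eq_sym neq_lift.
by exists x; rewrite -maxE ord_rcons_max.
Qed.

Lemma minors_border_row (R : comNzRingType) (S : set R) k m n
    (M : 'M[R]_(m, n)) (r : 'I_m) (g : 'I_k -> 'I_n) (j0 : 'I_k) :
  (forall i : 'I_m, i <= r)%N -> M r (g j0) = 1 ->
  (forall f : 'I_k -> 'I_m, {homo f : i j / (i < j)%N} ->
     (exists i, f i = r) -> ideal_gen S (\det (mxsub f g M))) ->
  forall f : 'I_k -> 'I_m, {homo f : i j / (i < j)%N} ->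
    ideal_gen S (\det (mxsub f g M)).
Proof.
move=> r_max Mr1 HS f hf; rewrite -det_tr trmx_mxsub.
apply: (minors_border_col (i0 := j0) r_max) => // [|f1 hf1 f1r].
  by rewrite mxE.
by rewrite -trmx_mxsub det_tr; apply: HS.
Qed.

(** Both steps need an entry 1 on the border and outside the corner ([r], [c]).
As [1 < k], the first of the increasing rows or columns is never the last one
of the matrix, and provides it. *)
Lemma minors_border (R : comNzRingType) (S : set R) k m n
    (M : 'M[R]_(m, n)) (r : 'I_m) (c : 'I_n) :
  (1 < k)%N -> (forall i : 'I_m, i <= r)%N -> (forall j : 'I_n, j <= c)%N ->
  (forall i, i != r -> M i c = 1) -> (forall j, j != c -> M r j = 1) ->
  (forall (f : 'I_k -> 'I_m) (g : 'I_k -> 'I_n),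
     {homo f : i j / (i < j)%N} -> {homo g : i j / (i < j)%N} ->
     (exists i, f i = r) -> (exists j, g j = c) ->
     ideal_gen S (\det (mxsub f g M))) ->
  forall p, is_minor k M p -> ideal_gen S p.
Proof.
move=> k_gt1 r_max c_max Mc1 Mr1 HS p [f [g [hf hg ->]]].
pose o0 := Ordinal (ltnW k_gt1); pose o1 := Ordinal k_gt1.
have first_lt q (h : 'I_k -> 'I_q) (x : 'I_q) : {homo h : i j / (i < j)%N} ->
    (forall i : 'I_q, i <= x)%N -> h o0 != x.
  move=> hh x_max; rewrite -val_eqE neq_ltn.
  by rewrite (leq_trans (hh o0 o1 isT) (x_max _)).
apply: (minors_border_col (i0 := o0) c_max) => // [|{}g {}hg gc].
  by rewrite Mc1 // first_lt.
apply: (minors_border_row (j0 := o0) r_max) => // [|{}f {}hf fr].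
  by rewrite Mr1 // first_lt.
exact: HS.
Qed.

(** * Minors using both the border row and the border column *)

(** Selects the indices [f] together with the border index; the sum [n + 1] is
kept so that the block decomposition in [CM] stays visible. *)
Definition ord_border n a (f : 'I_n -> 'I_a) (i : 'I_(n + 1)) : 'I_(a + 1) :=
  match split i with inl j => lshift 1 (f j) | inr o => rshift a o end.

Lemma ord_border_lshift n a (f : 'I_n -> 'I_a) i :
  ord_border f (lshift 1 i) = lshift 1 (f i).
Proof. by rewrite /ord_border (unsplitK (inl i)). Qed.

Lemma ord_border_rshift n a (f : 'I_n -> 'I_a) o :
  ord_border f (rshift n o) = rshift a o.
Proof. by rewrite /ord_border (unsplitK (inr o)). Qed.

Lemma ord_border_homo n a (f : 'I_n -> 'I_a) :
  {homo f : i j / (i < j)%N} -> {homo ord_border f : i j / (i < j)%N}.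
Proof.
move=> hf i j.
case: (split_ordP i) => i' ->; case: (split_ordP j) => j' ->;
  rewrite ?ord_border_lshift ?ord_border_rshift ?ord1 /= ?addn0.
- exact: hf.
- by rewrite ltn_ord.
- by rewrite ltnNge ltnW.
- by rewrite ltnn.
Qed.

Lemma leq_rshift1 a (x : 'I_(a + 1)) : (x <= rshift a (ord0 : 'I_1))%N.
Proof. by rewrite /= addn0 -ltnS -[a.+1]addn1. Qed.

(** An increasing selection that contains the largest index has it in last
position, which leaves an increasing selection of the inner indices. *)
Lemma ord_border_ex n a (f : 'I_(n + 1) -> 'I_(a + 1)) :
  {homo f : i j / (i < j)%N} -> (exists i, f i = rshift a ord0) ->
  exists2 f0 : 'I_n -> 'I_a,
    {homo f0 : i j / (i < j)%N} & f =1 ord_border f0.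
Proof.
move=> hf [i1 fi1].
have lt_fa i : (f (lshift 1 i) < a)%N.
  have lt_last : (f (lshift 1 i) < f (rshift n ord0))%N.
    by apply: hf; rewrite /= addn0.
  by have := leq_trans lt_last (leq_rshift1 _); rewrite /= addn0.
exists (fun i => Ordinal (lt_fa i)) => [i j ij|i]; first exact: hf.
case: (split_ordP i) => i' ->.
  by rewrite ord_border_lshift; apply: val_inj.
rewrite ord_border_rshift (ord1 i') -fi1.
case: (split_ordP i1) fi1 => [j ->|j -> _]; last by rewrite (ord1 j).
by move=> fj; have := lt_fa j; rewrite fj /= addn0 ltnn.
Qed.

Lemma mxsub_CM (K : fieldType) v n a b (f : 'I_n -> 'I_a) (g : 'I_n -> 'I_b)
    (M : 'M[{mpoly K[v]}]_(a, b)) :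
  mxsub (ord_border f) (ord_border g) (CM M) = CM (mxsub f g M).
Proof.
apply/matrixP => i j; rewrite mxE /CM.
case: (split_ordP i) => i' ->; case: (split_ordP j) => j' ->;
  rewrite ?ord_border_lshift ?ord_border_rshift.
- by rewrite !block_mxEul !mxE.
- by rewrite !block_mxEur !mxE.
- by rewrite !block_mxEdl !mxE.
- by rewrite !block_mxEdr !mxE.
Qed.

(** * Subsets as increasing families of indices *)

Section SubsetEnumeration.
Variable d : nat.
Implicit Types X Y : {set 'I_d}.

Let ltn_ord_trans : transitive (fun i j : 'I_d => (i < j)%N).
Proof. by move=> j i k; apply: ltn_trans. Qed.

Lemma sorted_enum X : sorted (fun i j : 'I_d => (i < j)%N) (enum X).
Proof.
rewrite /enum_mem -enumT; apply: sorted_filter => //.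
rewrite -(sorted_map (f := val) (e' := ltn)) val_enum_ord.
exact: iota_ltn_sorted.
Qed.

Lemma enum_val_homo X : {homo @enum_val _ (mem X) : i j / (i < j)%N}.
Proof.
move=> i j ij; have x0 := enum_val i.
rewrite !(enum_val_nth x0); apply: (sorted_ltn_nth ltn_ord_trans) => //.
- exact: sorted_enum.
- by rewrite inE -cardE.
- by rewrite inE -cardE.
Qed.

Lemma enum_val_mono X (i j : 'I_#|X|) :
  ((enum_val i < enum_val j) = (i < j))%N.
Proof.
have [/enum_val_homo ->//|ji|/val_inj ->] := ltngtP i j; last by rewrite ltnn.
by rewrite ltnNge ltnW // enum_val_homo.
Qed.

(** The increasing enumeration of a subset is unique, so enumerating the image
of an increasing family gives back that family. *)
Lemma subset_of_homo n X (f : 'I_n -> 'I_#|X|) :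
  {homo f : i j / (i < j)%N} ->
  exists (Y : {set 'I_d}) (hY : #|Y| = n), Y \subset X /\
    forall i, enum_val (cast_ord (esym hY) i) = enum_val (f i).
Proof.
move=> hf; pose F i := enum_val (f i).
have hF : {homo F : i j / (i < j)%N} by move=> i j /hf /enum_val_homo.
have injF : injective F.
  by move=> i j Fij; have [/hF|/hF|/val_inj//] := ltngtP i j; rewrite Fij ltnn.
have hY : #|[set F i | i : 'I_n]| = n by rewrite card_imset // card_ord.
exists [set F i | i : 'I_n], hY; split.
  by apply/fintype.subsetP => _ /imsetP[i _ ->]; apply: enum_valP.
move=> i.
have enumE : enum [set F i | i : 'I_n] = [seq F i | i <- enum 'I_n].
  apply: (irr_sorted_eq ltn_ord_trans) => [x|||x]; first exact: ltnn.
  - exact: sorted_enum.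
  - apply: (homo_sorted hF).
    rewrite -(sorted_map (f := val) (e' := ltn)) val_enum_ord.
    exact: iota_ltn_sorted.
  - rewrite mem_enum; apply/imsetP/mapP => -[j _ ->]; exists j => //.
    by rewrite mem_enum.
rewrite (enum_val_nth (F i)) enumE (nth_map i) ?size_enum_ord //=.
by rewrite nth_ord_enum.
Qed.

(** Converse of [subset_of_homo]: a subset of [X] is listed by an increasing
family of positions in [X]. *)
Lemma homo_of_subset n X Y (hY : #|Y| = n) : Y \subset X ->
  exists2 f : 'I_n -> 'I_#|X|, {homo f : i j / (i < j)%N} &
    forall i, enum_val (cast_ord (esym hY) i) = enum_val (f i).
Proof.
move=> /fintype.subsetP YX.
pose y i := enum_val (cast_ord (esym hY) i).
have Xy i : y i \in X by apply/YX/enum_valP.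
exists (fun i => enum_rank_in (Xy i) (y i)) => [i j ij|i].
  by rewrite -enum_val_mono !enum_rankK_in // enum_val_mono.
by rewrite enum_rankK_in.
Qed.

End SubsetEnumeration.

(** * Equality of the ideals *)

Section CayleyMengerIdeals.
Variables (K : fieldType) (d : nat).
Implicit Types A B C X Y : {set 'I_d}.

Lemma castmx_Gamma_sub n X Y X' Y' (hX : #|X'| = n) (hY : #|Y'| = n)
    (f : 'I_n -> 'I_#|X|) (g : 'I_n -> 'I_#|Y|) :
  (forall i, enum_val (cast_ord (esym hX) i) = enum_val (f i)) ->
  (forall i, enum_val (cast_ord (esym hY) i) = enum_val (g i)) ->
  castmx (hX, hY) (Gamma_sub K X' Y') = mxsub f g (Gamma_sub K X Y).
Proof.
by move=> fE gE; apply/matrixP => i j; rewrite castmxE !mxE /= fE gE.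
Qed.

Theorem minor_ideal_det_ideal A B C : minor_ideal K A B C = det_ideal K A B C.
Proof.
rewrite /minor_ideal /det_ideal.
have -> : (#|C| + 2 = (#|C| + 1) + 1)%N by rewrite -addnA.
have : (0 < #|C| + 1)%N by rewrite addn1.
move: (#|C| + 1)%N => n n_gt0.
apply/seteqP; split; apply: ideal_gen_sub.
  apply: (minors_border (r := rshift _ ord0) (c := rshift _ ord0)).
  - by rewrite addn1.
  - exact: leq_rshift1.
  - exact: leq_rshift1.
  - move=> i; case: (split_ordP i) => i' ->; last by rewrite (ord1 i') eqxx.
    by rewrite block_mxEur mxE.
  - move=> j; case: (split_ordP j) => j' ->; last by rewrite (ord1 j') eqxx.
    by rewrite block_mxEdl mxE.
  move=> f g hf hg /(ord_border_ex hf)[f0 hf0 fE] /(ord_border_ex hg)[g0 hg0 gE].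
  have [A' [hA [sA A'E]]] := subset_of_homo hf0.
  have [B' [hB [sB B'E]]] := subset_of_homo hg0.
  apply: ideal_gen_mem; exists A', B', hA, hB; split=> //.
  rewrite (castmx_Gamma_sub A'E B'E) -mxsub_CM; congr (\det _).
  exact: eq_mxsub.
move=> p [A' [B' [hA [hB [sA sB ->]]]]].
have [f hf A'E] := homo_of_subset hA sA.
have [g hg B'E] := homo_of_subset hB sB.
apply: ideal_gen_mem; exists (ord_border f), (ord_border g).
split; [exact: ord_border_homo | exact: ord_border_homo |].
by rewrite (castmx_Gamma_sub A'E B'E) mxsub_CM.
Qed.

End CayleyMengerIdeals.

Theorem theorem3p6 (R : realType) (d : nat) :
  (forall A B C : {set 'I_d}, pairwise_disjoint A B C ->
     minor_ideal R[i]%C A B C = det_ideal R[i]%C A B C)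
  /\
  (forall e : rel 'I_d, ssrbool.symmetric e ->
     eCI R[i]%C e =
     ideal_sum (ci_triples e) (fun t => det_ideal R[i]%C t.1.1 t.1.2 t.2)).
Proof.
split=> [A B C _|e _]; first exact: minor_ideal_det_ideal.
rewrite /eCI; congr ideal_sum; apply/funext => t.
exact: minor_ideal_det_ideal.
Qed.
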